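(* Let $k$ be a positive integer and let $V\subset\mathbb{P}(1,1,1,k)$ be a smooth weighted hypersurface. Then there is no codimension one regular distribution on $V$.
   Context: $\mathbb{P}(1,1,1,k)=(\mathbb{C}^4-\{0\})/\mathbb{C}^*$ with action $t\cdot(z_0,z_1,z_2,z_3)=(tz_0,tz_1,tz_2,t^kz_3)$. A weighted hypersurface $V$ of degree $a$ is the scheme-theoretic zero locus of a weighted homogeneous polynomial $f$ of degree $a$ ($\deg z_0=\deg z_1=\deg z_2=1$, $\deg z_3=k$). Smooth means that $V$ is a complex manifold and that $\{f=0\}\cap(\mathbb{C}^4-\{0\})$ is smooth of codimension one with this scheme structure. Distributions. A codimension one holomorphic distribution $\mathcal{D}$ of degree $d$ on $V$ is given by a nonzero section of $\Omega^1_V(d)=\Omega^1_V\otimes\mathcal{O}_{\mathbb{P}(1,1,1,k)}(d)|_V$. Standing assumption: $d\geq1$ and the section lies in the image of the restriction map $H^0(\mathbb{P}(1,1,1,k),\Omega^1_{\mathbb{P}(1,1,1,k)}\otimes\mathcal{O}(d))\to H^0(V,\Omega^1_V(d))$. $\mathrm{Sing}(\mathcal{D})$ is the zero set of the section on $V$, and $\mathcal{D}$ is regular if $\mathrm{Sing}(\mathcal{D})=\varnothing$. *)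

(* Defs.v *)
From HB Require Import structures.
(* The notations of mpoly clash with those of MathComp-Analysis. *)
From mathcomp Require Import -(notations) mpoly.
From mathcomp Require Import all_boot all_order all_algebra.
From mathcomp Require Import all_classical all_reals all_analysis.
From mathcomp Require Import complex.

Set Implicit Arguments.
Unset Strict Implicit.
Unset Printing Implicit Defensive.
Import Order.TTheory GRing.Theory Num.Theory numFieldNormedType.Exports.
Local Open Scope classical_set_scope.
Local Open Scope ring_scope.
Local Open Scope quotient_scope.

(* R[i] itself carries no topology; as a numClosedFieldType it gets the one
   of its norm, and differentiability over it is complex differentiability. *)
Definition CC (R : realType) : numClosedFieldType := R[i].

Definition wt (k : nat) (i : 'I_4) : nat := if i == ord_max then k else 1%N.

Definition wdeg (k : nat) (m : multinom 4) : nat := (\sum_(i < 4) m i * wt k i)%N.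

Lemma wdeg_measure0 k : wdeg k (@mnm0 4) = 0%N.
Proof. by rewrite /wdeg big1 // => i _; rewrite mnm0E. Qed.

Lemma wdeg_measureD k : {morph wdeg k : m1 m2 / mnm_add m1 m2 >-> (m1 + m2)%N}.
Proof.
move=> m1 m2; rewrite /wdeg -big_split /=.
by apply: eq_bigr => i _; rewrite mnmDE mulnDl.
Qed.

HB.instance Definition _ k :=
  mpoly.isMeasure.Build 4 (wdeg k) (wdeg_measure0 k) (wdeg_measureD k).

Section WeightedProjectiveSpace.
Variables (R : realType) (k : nat).
Local Notation C := (CC R).

Definition punctured : set 'rV[C]_4 := [set z | z != 0].

Definition wact (t : C) (z : 'rV[C]_4) : 'rV[C]_4 :=
  \row_i (t ^+ wt k i * z 0 i).

Definition same_orbit (x y : punctured) : bool :=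
  `[< exists2 t : C, t != 0 & val y = wact t (val x) >].

Lemma same_orbit_refl : reflexive same_orbit.
Proof.
move=> x; apply/asboolP; exists 1; first exact: oner_neq0.
by apply/rowP => i; rewrite mxE expr1n mul1r.
Qed.

Lemma same_orbit_symW (x y : punctured) : same_orbit x y -> same_orbit y x.
Proof.
move=> /asboolP[t t0 e]; apply/asboolP; exists t^-1; first by rewrite invr_eq0.
apply/rowP => i; rewrite e !mxE mulrA -exprMn mulVf //.
by rewrite expr1n mul1r.
Qed.

Lemma same_orbit_sym : symmetric same_orbit.
Proof. by move=> x y; apply/idP/idP; exact: same_orbit_symW. Qed.

Lemma same_orbit_trans : transitive same_orbit.
Proof.
move=> y x z /asboolP[t t0 ey] /asboolP[s s0 ez]; apply/asboolP.
exists (s * t); first by rewrite mulf_neq0.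
by apply/rowP => i; rewrite ez ey !mxE mulrA exprMn.
Qed.

Definition same_orbit_rel :=
  EquivRel same_orbit same_orbit_refl same_orbit_sym same_orbit_trans.

Definition wproj := {eq_quot same_orbit_rel}.

HB.instance Definition _ := Topological.copy wproj (quotient_topology wproj).
HB.instance Definition _ := Quotient.on wproj.

Definition wpi (z : punctured) : wproj := \pi_wproj z.

Section Hypersurface.
Variable f : mpoly 4 C.

Definition evalv (p : mpoly 4 C) (z : punctured) : C := meval (val z 0) p.

Definition punctured_cone : set punctured := [set z | evalv f z = 0].

Definition hypersurface : set wproj := wpi @` punctured_cone.

(* Jacobian criterion for the scheme {f = 0} in C^4 - {0}. *)
Definition smooth_cone : Prop :=
  forall z, punctured_cone z -> exists i, evalv (mderiv i f) z != 0.

(* The structure sheaf of the analytic subspace V of P(1,1,1,k): its sections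
   over the trace on V of an open set O are the functions whose pullback to the
   cone is locally the restriction of a holomorphic function on C^4.  This is
   the sheaf of the scheme structure because the cone, when smooth, is reduced. *)
Definition holomorphic_on_hypersurface (O : set wproj) (h : wproj -> C) : Prop :=
  forall z : punctured, punctured_cone z -> O (wpi z) ->
    exists G : 'rV[C]_4 -> C,
      (\forall y \near val z, differentiable G y) /\
      (\forall y \near z, punctured_cone y -> h (wpi y) = G (val y)).

Definition holomorphic_on (W : set 'rV[C]_2) (g : 'rV[C]_2 -> C) : Prop :=
  forall u, W u -> differentiable g u.

(* (O, phi) identifies the trace of V on O, as a ringed space, with an open subset of C^2. *)
Definition is_chart (O : set wproj) (phi : wproj -> 'rV[C]_2) : Prop :=
  let D := hypersurface `&` O in
  [/\ open O,
      set_inj D phi,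
      {within D, continuous phi},
      (forall U, open U -> open (phi @` (D `&` U))) &
      forall (W : set 'rV[C]_2) (g : 'rV[C]_2 -> C),
        open W -> W `<=` phi @` D ->
        (holomorphic_on W g <->
         holomorphic_on_hypersurface (O `&` phi @^-1` W) (g \o phi))].

(* Hausdorffness and second countability are inherited from P(1,1,1,k). *)
Definition complex_surface : Prop :=
  forall x, hypersurface x -> exists O phi, O x /\ is_chart O phi.

Definition smooth_hypersurface : Prop := smooth_cone /\ complex_surface.

(* By the Euler sequence 0 -> Omega^1(d) -> (+)_i O(d - w_i) -> O(d) -> 0, the
   global sections of Omega^1(d) on P(1,1,1,k) are the forms
   omega = sum_i omega_i dz_i whose contraction with the Euler field
   sum_i w_i z_i d/dz_i vanishes and with omega_i of weighted degree d - w_i.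
   The degree is expressed through z_i * omega_i so that omega_i = 0 is forced
   when w_i > d.  (For k > 1 these are the reflexive differentials at the
   quotient singularity [0:0:0:1], through which a smooth V does not pass.) *)
Definition twisted_form (d : nat) (omega : 'I_4 -> mpoly 4 C) : Prop :=
  (forall i, (mpolyX C (mnm1 i) * omega i) \is ishomog1 d (wdeg k)) /\
  \sum_(i < 4) (mpolyX C (mnm1 i) * omega i) *+ wt k i = 0.

Definition cone_tangent (z : punctured) : set 'rV[C]_4 :=
  [set v | \sum_(i < 4) evalv (mderiv i f) z * v 0 i = 0].

(* At the point of V under z the fibre of Omega^1_V(d) is the space of linear forms
   on the tangent space of the cone at z that kill the Euler vector. *)
Definition section_vanishes_at (omega : 'I_4 -> mpoly 4 C) (z : punctured) : Prop :=
  forall v, cone_tangent z v ->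
    \sum_(i < 4) evalv (omega i) z * v 0 i = 0.

Definition sing (omega : 'I_4 -> mpoly 4 C) : set wproj :=
  wpi @` [set z | punctured_cone z /\ section_vanishes_at omega z].

(* Since V is reduced, the restriction of omega to V is a nonzero section
   exactly when it does not vanish at some point of V. *)
Definition codim1_distribution (d : nat) (omega : 'I_4 -> mpoly 4 C) : Prop :=
  [/\ (1 <= d)%N, twisted_form d omega &
      exists2 z, punctured_cone z & ~ section_vanishes_at omega z].

Definition regular_distribution (omega : 'I_4 -> mpoly 4 C) : Prop := sing omega = set0.

End Hypersurface.
End WeightedProjectiveSpace.

(* Main.v *)
From HB Require Import structures.
Require Import Defs.
From mathcomp Require Import -(notations) mpoly.
From mathcomp Require Import all_boot all_order all_algebra.
From mathcomp Require Import all_classical all_reals all_analysis.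
From mathcomp Require Import finmap complex ring.

(** The proof is an algebraic form of Bott's vanishing argument.  A regular
    codimension one distribution on a surface is integrable, so its normal
    bundle O(d) carries a flat partial connection along the leaves; this forces
    c_1(O(d))^2 = 0, which is absurd for d >= 1 since O(d) is then ample.

    Everything takes place on the affine cone over V, with coordinate ring
    A = C[z]/(f), where the distribution is a polynomial one-form omega killed
    by the Euler field E = sum_i w_i z_i d/dz_i.  Cartan's formula gives
    i_E (d omega) = d omega (the scalar d times omega) and i_E (df) = 0 in A,
    so the four-form d omega /\ omega /\ df is killed by E, hence is zero in A:
    this is integrability.  Regularity says that omega and df are independent
    at every point of the cone other than the origin.  If there is a one-form
    theta with coefficients in A such that
        d omega /\ df = theta /\ omega /\ df,
    which is the connection form of the Bott connection, then contraction with E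
    yields (d - theta(E)) omega /\ df = 0, so that theta(E) = d in A.  But
    theta(E) = sum_i w_i z_i theta_i vanishes at the origin, and so does f, a
    contradiction ([no_regular_form]).

    Locally theta comes from Cramer's rule.  Two local choices differ by a
    multiple of omega (modulo df), and these multiples form a one-cocycle on the
    punctured cone with values in the structure sheaf.  It is a coboundary
    because A is Cohen-Macaulay of dimension three.  [division2] is this gluing,
    a case of Saito's generalization of the de Rham lemma: it needs three
    elements of the ideal of minors of (omega, df) that form a regular sequence.
    They are found as follows.  A weighted shear of coordinates makes f, up to
    a scalar, monic in z_0, and then arbitrary powers of the three other new
    coordinates form a regular sequence modulo f ([weighted_parameters]).  These
    coordinates vanish at the origin, the only common zero of f and the minors,
    so some of their powers lie in the ideal by the [nullstellensatz]. *)

Set Implicit Arguments.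
Unset Strict Implicit.
Unset Printing Implicit Defensive.
Import Order.TTheory GRing.Theory Num.Theory.
Local Open Scope ring_scope.
Local Open Scope quotient_scope.

(** * Division of two-forms by a pair of one-forms *)

Section Division.
Variables (A : comNzRingType) (T : finType).
Implicit Types (w phi alpha theta : T -> A) (D : T -> T -> A) (x y z : A).

Definition regular_sequence x y z : Prop :=
  [/\ forall a, x * a = 0 -> a = 0,
      forall a b, y * a = x * b -> exists c, a = x * c &
      forall a b c, z * a = x * b + y * c -> exists b' c', a = x * b' + y * c'].

(** The coefficients of w /\ phi. *)
Definition minor w phi i j : A := w i * phi j - w j * phi i.

Definition in_minor_ideal w phi x : Prop :=
  exists c : T * T -> A, x = \sum_p c p * minor w phi p.1 p.2.

(** The coefficients of alpha /\ w /\ phi. *)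
Definition wedge12 alpha w phi i j l : A :=
  alpha i * minor w phi j l + alpha j * minor w phi l i
  + alpha l * minor w phi i j.

(** The coefficients of D /\ phi, for a two-form D given by its skew matrix.
    *)
Definition wedge21 D phi i j l : A :=
  D i j * phi l + D j l * phi i + D l i * phi j.

(** The coefficients of D /\ w /\ phi. *)
Definition wedge22 D w phi i j k l : A :=
  D i j * minor w phi k l - D i k * minor w phi j l + D i l * minor w phi j k
  + D j k * minor w phi i l - D j l * minor w phi i k + D k l * minor w phi i j.

Lemma minor_mul_eq0 w phi x c :
  in_minor_ideal w phi x -> (forall i j, c * minor w phi i j = 0) -> c * x = 0.
Proof.
by move=> [b ->] cW; rewrite mulr_sumr big1 // => p _; rewrite mulrCA cW mulr0.
Qed.

Lemma minor_indep w phi x u v : in_minor_ideal w phi x ->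
  (forall a, x * a = 0 -> a = 0) ->
  (forall i, u * w i + v * phi i = 0) -> u = 0 /\ v = 0.
Proof.
move=> xW x_reg uv0; split; apply: x_reg; rewrite mulrC;
  apply: minor_mul_eq0 xW _ => i j; rewrite /minor.
  have -> : u * (w i * phi j - w j * phi i) =
    (u * w i + v * phi i) * phi j - (u * w j + v * phi j) * phi i by ring.
  by rewrite !uv0 !mul0r subr0.
have -> : v * (w i * phi j - w j * phi i) =
  (u * w j + v * phi j) * w i - (u * w i + v * phi i) * w j by ring.
by rewrite !uv0 !mul0r subr0.
Qed.

(** Contract the identity alpha /\ w /\ phi = 0 with a bivector c such that
    c(w /\ phi) = x: the term carrying alpha is x * alpha, and the others are
    multiples of w and phi. *)
Lemma division1_local w phi alpha x : in_minor_ideal w phi x ->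
  (forall i j l, wedge12 alpha w phi i j l = 0) ->
  exists u v, forall l, x * alpha l = u * w l + v * phi l.
Proof.
move=> [c ->] aW.
exists (\sum_p c p * (alpha p.1 * phi p.2 - alpha p.2 * phi p.1)).
exists (\sum_p c p * (alpha p.2 * w p.1 - alpha p.1 * w p.2)) => l.
rewrite !mulr_suml -big_split /=; apply: eq_bigr => -[i j] _ /=.
apply: subr0_eq; rewrite -[RHS](mulr0 (c (i, j))) -(aW i j l).
by rewrite /wedge12 /minor; ring.
Qed.

(** The coefficients of w and phi over the two open sets x <> 0 and y <> 0
    agree on the intersection by uniqueness, and glue because x, y is a
    regular sequence. *)
Lemma division1 w phi alpha x y : in_minor_ideal w phi x ->
  in_minor_ideal w phi y ->
  (forall a, x * a = 0 -> a = 0) ->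
  (forall a b, y * a = x * b -> exists c, a = x * c) ->
  (forall i j l, wedge12 alpha w phi i j l = 0) ->
  exists u v, forall l, alpha l = u * w l + v * phi l.
Proof.
move=> xW yW x_reg y_reg aW.
have [u [v uvE]] := division1_local xW aW.
have [u' [v' uvE']] := division1_local yW aW.
have [] := @minor_indep w phi x (y * u - x * u') (y * v - x * v') xW x_reg.
  move=> l; have -> : (y * u - x * u') * w l + (y * v - x * v') * phi l =
    y * (u * w l + v * phi l) - x * (u' * w l + v' * phi l) by ring.
  by rewrite -uvE -uvE'; ring.
move=> /subr0_eq/y_reg[s us] /subr0_eq/y_reg[t vt].
exists s, t => l; apply/subr0_eq/x_reg.
by rewrite mulrBr uvE us vt; ring.
Qed.

(** As for one-forms: contract D /\ w /\ phi = 0 with a bivector c such that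
    c(w /\ phi) = x. *)
Lemma division2_local w phi D x : in_minor_ideal w phi x ->
  (forall i j, D i j = - D j i) ->
  (forall i j k l, wedge22 D w phi i j k l = 0) ->
  exists theta, forall i j l,
    x * wedge21 D phi i j l = wedge12 theta w phi i j l.
Proof.
move=> [c ->] D_skew DW.
pose theta i := \sum_p c p * (D i p.1 * phi p.2 - D i p.2 * phi p.1).
pose eta i :=
  \sum_p c p * (D i p.2 * w p.1 - D i p.1 * w p.2 - D p.1 p.2 * w i).
have E i j : (\sum_p c p * minor w phi p.1 p.2) * D i j =
    theta i * w j - theta j * w i + (eta i * phi j - eta j * phi i).
  rewrite !mulr_suml -!sumrB -big_split; apply: eq_bigr => -[k l] _ /=.
  apply: subr0_eq; rewrite -[RHS](mulr0 (c (k, l))) -(DW i j k l).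
  by rewrite /wedge22 /minor; ring.
exists theta => i j l; rewrite /wedge21 !mulrDr !mulrA !E /wedge12 /minor.
by ring.
Qed.

(** Saito's division lemma for two-forms. The local quotients theta_x, theta_y
    and theta_z differ by multiples u of w (and multiples of phi); u is a
    one-cocycle for the cover by x <> 0, y <> 0, z <> 0, so the cocycle
    relation puts z * u in the ideal (x, y). Regularity of z modulo (x, y)
    then makes u a coboundary, and the local quotients can be corrected so as
    to glue. *)
Theorem division2 w phi D x y z : in_minor_ideal w phi x ->
  in_minor_ideal w phi y -> in_minor_ideal w phi z ->
  regular_sequence x y z ->
  (forall i j, D i j = - D j i) ->
  (forall i j k l, wedge22 D w phi i j k l = 0) ->
  exists theta, forall i j l, wedge21 D phi i j l = wedge12 theta w phi i j l.
Proof.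
move=> xW yW zW [x_reg y_reg z_reg] D_skew DW.
have [a aE] := division2_local xW D_skew DW.
have [b bE] := division2_local yW D_skew DW.
have [c cE] := division2_local zW D_skew DW.
have div (p q : A) (f g : T -> A) :
    (forall i j l, p * wedge21 D phi i j l = wedge12 f w phi i j l) ->
    (forall i j l, q * wedge21 D phi i j l = wedge12 g w phi i j l) ->
    exists u v, forall l, q * f l - p * g l = u * w l + v * phi l.
  move=> fE gE; apply: (division1 xW yW x_reg y_reg) => i j l.
  have -> : wedge12 (fun l => q * f l - p * g l) w phi i j l =
     q * wedge12 f w phi i j l - p * wedge12 g w phi i j l.
    by rewrite /wedge12; ring.
  by rewrite -fE -gE; ring.
have [u [v abE]] := div _ _ _ _ aE bE.
have [u' [v' acE]] := div _ _ _ _ aE cE.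
have [u'' [v'' bcE]] := div _ _ _ _ bE cE.
(* the cocycle relation, from the uniqueness of the coefficients *)
have [] := @minor_indep w phi x (z * u - (y * u' - x * u''))
             (z * v - (y * v' - x * v'')) xW x_reg.
  move=> l; have -> : (z * u - (y * u' - x * u'')) * w l +
      (z * v - (y * v' - x * v'')) * phi l =
      z * (u * w l + v * phi l) - y * (u' * w l + v' * phi l)
      + x * (u'' * w l + v'' * phi l) by ring.
  by rewrite -abE -acE -bcE; ring.
move=> /subr0_eq zu /subr0_eq zv.
have [|s' [s us]] := z_reg u (- u'') u'; first by rewrite zu; ring.
have [|t' [t vt]] := z_reg v (- v'') v'; first by rewrite zv; ring.
(* theta_x corrected by the coboundary; it is divisible by x *)
pose a' l := a l - s * w l - t * phi l.
have /choice : forall l, exists e, a' l = x * e.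
  move=> l; apply: (y_reg _ (b l + s' * w l + t' * phi l)).
  have : y * a l = u * w l + v * phi l + x * b l by rewrite -abE subrK.
  by rewrite /a' 2!mulrBr us vt => ->; ring.
move=> [theta thetaE]; exists theta => i j l; apply/subr0_eq/x_reg.
rewrite mulrBr aE.
have -> : x * wedge12 theta w phi i j l = wedge12 a' w phi i j l.
  by rewrite /wedge12 !thetaE; ring.
by rewrite /wedge12 /a' /minor; ring.
Qed.
End Division.

(** * Nullstellensatz over an uncountable field *)

Section Ideals.
Variable S : comNzRingType.
Implicit Types (I J : set S) (s u v : S).

Definition is_ideal I : Prop :=
  [/\ I 0, forall u v, I u -> I v -> I (u + v) & forall c u, I u -> I (c * u)].

Lemma ideal_sum I (T : Type) (r : seq T) (P : pred T) (F : T -> S) :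
  is_ideal I -> (forall i, P i -> I (F i)) -> I (\sum_(i <- r | P i) F i).
Proof. by move=> [I0 ID _] IF; apply: (big_ind I). Qed.

Lemma ideal_opp I u : is_ideal I -> I u -> I (- u).
Proof. by move=> [_ _ IM] Iu; rewrite -mulN1r; exact: IM. Qed.

(** Avoiding all powers of s, rather than just 1, gives the Nullstellensatz
    for powers directly, in place of Rabinowitsch's additional variable. *)
Lemma maximal_ideal_avoiding I s : is_ideal I -> (forall n, ~ I (s ^+ n)) ->
  exists J, [/\ is_ideal J, I `<=` J, forall n, ~ J (s ^+ n) &
    forall u, ~ J u -> exists n q, J (q * u - s ^+ n)]%classic.
Proof.
move=> idI IsN.
pose P J := J = set0 \/
  [/\ is_ideal J, I `<=` J & forall n, ~ J (s ^+ n)]%classic.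
have [F FP Ftot|J [PJ maxJ]] := @Zorn_bigcup _ P.
  have [[K FK K0]|F0] := pselect (exists2 K, F K & K <> set0); last first.
    left; apply/seteqP; split=> // x [K FK Kx]; apply: F0; exists K => // K0.
    by rewrite K0 in Kx.
  have goodF L x : F L -> L x ->
      [/\ is_ideal L, I `<=` L & forall n, ~ L (s ^+ n)]%classic.
    by move=> FL Lx; case: (FP _ FL) => // L0; rewrite L0 in Lx.
  have [[K00 _ _] IK _] : [/\ is_ideal K, I `<=` K &
       forall n, ~ K (s ^+ n)]%classic by case: (FP _ FK).
  right; split; last 2 first.
  - by move=> x Ix; exists K => //; exact: IK.
  - by move=> n [L FL Ls]; have [_ _ /(_ n)] := goodF _ _ FL Ls.
  split; first by exists K.
  - move=> u v [L FL Lu] [M FM Mv].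
    have [[_ LD _] _ _] := goodF _ _ FL Lu.
    have [[_ MD _] _ _] := goodF _ _ FM Mv.
    have [LM|ML] := Ftot _ _ FL FM.
      by exists M => //; apply: MD => //; exact: LM.
    by exists L => //; apply: LD => //; exact: ML.
  - move=> c u [L FL Lu]; have [[_ _ LM] _ _] := goodF _ _ FL Lu.
    by exists L => //; exact: LM.
have {PJ} [idJ IJ JsN] : [/\ is_ideal J, I `<=` J &
    forall n, ~ J (s ^+ n)]%classic.
  case: PJ => // J0; exfalso; apply: (maxJ I); last by right; split.
  by rewrite J0; split=> [x []|sub]; case: idI => I0 _ _; case: (sub 0 I0).
exists J; split=> // u Ju; apply: contrapT => noq.
have [J0 JD JM] := idJ.
(* the ideal J + (u) is larger than J *)
apply: (maxJ [set p | exists2 q, J (p - q * u) & True]%classic).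
  split=> [p Jp|sub]; first by exists 0; rewrite // mul0r subr0.
  apply: Ju; apply: sub; exists 1 => //.
  by rewrite mul1r subrr.
right; split.
- split; first by exists 0; rewrite // mul0r subr0.
  + move=> p p' [q Jq _] [q' Jq' _]; exists (q + q') => //.
    have -> : p + p' - (q + q') * u = (p - q * u) + (p' - q' * u) by ring.
    exact: JD.
  + move=> c p [q Jq _]; exists (c * q) => //.
    have -> : c * p - c * q * u = c * (p - q * u) by ring.
    exact: JM.
- by move=> p Ip; exists 0 => //; rewrite mul0r subr0; exact: IJ.
move=> n [q Jq _]; apply: noq; exists n, q.
by rewrite -opprB; exact: ideal_opp.
Qed.

Lemma maximal_avoiding_prime J s : is_ideal J -> (forall n, ~ J (s ^+ n)) ->
  (forall u, ~ J u -> exists n q, J (q * u - s ^+ n)) ->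
  forall u v, J (u * v) -> J u \/ J v.
Proof.
move=> idJ JsN maxJ u v Juv; have [_ JD JM] := idJ.
apply: contrapT => /not_orP[/maxJ[n [q Ju]] /maxJ[m [r Jv]]].
apply: (JsN (n + m)%N).
have -> : s ^+ (n + m) = q * r * (u * v) +
  ((- (r * v)) * (q * u - s ^+ n) + (- s ^+ n) * (r * v - s ^+ m)).
  by rewrite exprD; ring.
by apply: (JD); [exact: JM | apply: JD; exact: JM].
Qed.

End Ideals.

Section Nullstellensatz.
Local Open Scope classical_set_scope.
Variables (F : closedFieldType) (n : nat).
Hypothesis F_uncountable : ~ countable [set: F].
Local Notation S := (mpoly n F).
Local Notation Xv i := (mpolyX F (mnm1 i) : S).

(** Polynomials of bounded degree form a finite-dimensional space. *)
Lemma mpoly_lin_dep (d : nat) (q : F -> S) (A : set F) : infinite_set A ->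
  (forall c, A c -> mmeasure mdeg (q c) = d) ->
  exists (m : nat) (c : 'I_m -> F) (v : 'I_m -> F),
    [/\ injective c, forall j, A (c j), exists j, v j != 0 &
        \sum_j v j *: q (c j) = 0].
Proof.
move=> Ainf qd; pose m := #|{: bmultinom n d}|.+1.
have [X XA mX] := infinite_set_fset m Ainf.
have ltX (j : 'I_m) : (j < size (enum_fset X))%N.
  by apply: leq_trans (ltn_ord j) _.
pose c (j : 'I_m) := nth 0 (enum_fset X) j.
have Ac j : A (c j) by apply: XA; exact: mem_nth.
pose M := \matrix_(j < m, k < #|{: bmultinom n d}|)
  mcoeff (bmnm (enum_val k)) (q (c j)).
have : kermx M != 0.
  rewrite kermx_eq0 /row_free neq_ltn; apply/orP; left.
  exact: leq_ltn_trans (rank_leq_col M) _.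
move=> /rowV0Pn[v /sub_kermxP vM v0].
exists m, c, (v 0); split=> //.
- move=> j k /eqP; rewrite nth_uniq ?ltX ?fset_uniq // => /eqP jk.
  exact: val_inj.
- apply: contrapT => v00; case/eqP: v0; apply/rowP => j; rewrite mxE.
  by apply/eqP; apply: contrapT => /negP vj; apply: v00; exists j.
apply/mpolyP => b; rewrite mcoeff0 raddf_sum /=.
have [bd|db] := ltnP (mdeg b) d; last first.
  rewrite big1 // => j _; rewrite mcoeffZ.
  suff -> : mcoeff b (q (c j)) = 0 by rewrite mulr0.
  apply/eqP; rewrite mcoeff_eq0; apply/negP => /(mmeasure_mnm_lt mdeg).
  by rewrite qd // ltnNge db.
move/rowP: vM => /(_ (enum_rank (BMultinom bd))); rewrite !mxE => vb.
rewrite -[RHS]vb.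
by apply: eq_bigr => j _; rewrite mcoeffZ mxE enum_rankK.
Qed.

Lemma uncountable_pigeonhole (key : F -> nat * nat) :
  exists k, infinite_set [set c | key c = k].
Proof.
apply: contrapT => fin; apply: F_uncountable.
have -> : [set: F] = \bigcup_(k in [set: nat * nat]) [set c | key c = k].
  by apply/seteqP; split=> // c _; exists (key c).
apply: bigcup_countable => // k _; apply: finite_set_countable.
by apply: contrapT => inf; apply: fin; exists k.
Qed.

(** Localized at s, the quotient by J is a field, of countable dimension over
    F. If the coordinate i were not constant in it, the inverses of Xv i - c,
    for c in F, would be uncountably many linearly independent elements.
    Concretely, uncountably many c leave infinitely many whose inverses have
    numerators of the same degree and the same denominator; a linear relation
    among these yields, after clearing denominators, a nonzero polynomial in
    Xv i that lies in J, and it has a linear factor in J since it splits and J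
    is prime. *)
Lemma coordinate_constant (J : set S) (s : S) (i : 'I_n) : is_ideal J ->
  (forall k, ~ J (s ^+ k)) ->
  (forall u, ~ J u -> exists k q, J (q * u - s ^+ k)) ->
  exists c, J (Xv i - mpolyC n c).
Proof.
move=> idJ JsN maxJ; apply: contrapT => noc.
have [J0 JD JM] := idJ.
have prJ := maximal_avoiding_prime idJ JsN maxJ.
have /choice[kq kqE] : forall c, exists kq : nat * S,
    J (kq.2 * (Xv i - mpolyC n c) - s ^+ kq.1).
  move=> c; have [|k [q Jq]] := maxJ (Xv i - mpolyC n c).
    by move=> Jc; apply: noc; exists c.
  by exists (k, q).
(* infinitely many inverses share the denominator s ^+ k and the degree of
   the numerator *)
have [[k d] Ainf] :=
  uncountable_pigeonhole (fun c => ((kq c).1, mmeasure mdeg (kq c).2)).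
have [c []|m [c [v [c_inj Ac [j0 vj0] vq]]]] :=
  mpoly_lin_dep (d := d) (q := fun c => (kq c).2) Ainf.
  by [].
(* the numerator of the linear relation between the inverses *)
pose r := \sum_j v j *: \prod_(l < m | l != j) ('X - (c l)%:P).
have r_neq0 : r != 0.
  apply/eqP => /(congr1 (fun p : {poly F} => p.[c j0])).
  rewrite horner0 horner_sum.
  rewrite (bigD1 j0) //= [X in _ + X]big1 ?addr0; last first.
    move=> j jj0; rewrite hornerZ horner_prod (bigD1 j0) /=; last first.
      by rewrite eq_sym.
    by rewrite hornerXsubC subrr mul0r mulr0.
  move/eqP; rewrite hornerZ mulf_eq0 (negbTE vj0) /= horner_prod.
  apply/negP/prodf_neq0 => l lj0; rewrite !hornerE subr_eq0.
  by apply: contra lj0 => /eqP/c_inj ->.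
pose h := horner_alg (A := S) (Xv i).
have hZ (b : F) p : h (b *: p) = b *: h p.
  by rewrite /h -mul_polyC rmorphM /= horner_algC mulr_algl.
have hprod (I : Type) (e : seq I) (P : pred I) (G : I -> {poly F}) :
  h (\prod_(l <- e | P l) G l) = \prod_(l <- e | P l) h (G l).
  exact: rmorph_prod.
have hXC a : h ('X - a%:P) = Xv i - mpolyC n a.
  by rewrite /h raddfB /= horner_algX horner_algC -alg_mpolyC.
have Jh : J (h r).
  have : J (s ^+ k * h r).
    have -> : s ^+ k * h r = \sum_j
        (s ^+ k * h (v j *: \prod_(l < m | l != j) ('X - (c l)%:P))
       - (v j *: (kq (c j)).2) * \prod_l (Xv i - mpolyC n (c l))).
      by rewrite sumrB -mulr_suml vq mul0r subr0 -mulr_sumr /h /r raddf_sum.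
    apply: ideal_sum => // j _.
    rewrite hZ hprod [\prod_l _](bigD1 j) //=.
    under eq_bigr do rewrite hXC.
    set Pj := \prod_(_ < m | _) _.
    rewrite -!mul_mpolyC.
    have -> : s ^+ k * (mpolyC n (v j) * Pj) -
        mpolyC n (v j) * (kq (c j)).2 * ((Xv i - mpolyC n (c j)) * Pj) =
        - (mpolyC n (v j) * Pj) *
          ((kq (c j)).2 * (Xv i - mpolyC n (c j)) - s ^+ k).
      by ring.
    by apply: JM; have := kqE (c j); have [-> _] := Ac j.
  by case/prJ => // /JsN.
have [a rE] := closed_field_poly_normal r.
move: Jh; rewrite rE hZ hprod => Jh.
have {Jh} : J (\prod_(z <- a) (Xv i - mpolyC n z)).
  move/(JM (mpolyC n (lead_coef r)^-1)): Jh.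
  rewrite mul_mpolyC scalerA mulVf ?lead_coef_eq0 // scale1r.
  by under eq_bigr do rewrite hXC.
elim: a {rE} => [|z a IH]; first by rewrite big_nil -(expr0 s) => /JsN.
rewrite big_cons => /prJ[Jz|/IH//].
by apply: noc; exists z.
Qed.

(** If no power of p is in the ideal of the g t, take an ideal J maximal among
    those containing the g t and no power of p. All coordinates are constants
    modulo J, which gives a common zero of J where p does not vanish. *)
Theorem nullstellensatz (T : finType) (g : T -> S) (p : S) :
  (forall z, (forall t, meval z (g t) = 0) -> meval z p = 0) ->
  exists k (c : T -> S), p ^+ k = \sum_t c t * g t.
Proof.
move=> p0.
pose I : set S := [set q | exists c : T -> S, q = \sum_t c t * g t]%classic.
suff [k []] : exists k, I (p ^+ k) by move=> c pE; exists k, c.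
have idI : is_ideal I.
  split; first by exists (fun=> 0); rewrite big1 // => t _; rewrite mul0r.
  - move=> _ _ [c ->] [c' ->]; exists (fun t => c t + c' t).
    by rewrite -big_split; apply: eq_bigr => t _; rewrite mulrDl.
  - move=> a _ [c ->]; exists (fun t => a * c t).
    by rewrite mulr_sumr; apply: eq_bigr => t _; rewrite mulrA.
apply: contrapT => noI.
have [|J [idJ IJ JpN maxJ]] := maximal_ideal_avoiding (s := p) idI.
  by move=> k Ik; apply: noI; exists k.
have [J0 JD JM] := idJ.
have /choice[z zE] i := coordinate_constant i idJ JpN maxJ.
(* evaluation at z is reduction modulo J *)
have Jev q : J (q - mpolyC n (meval z q)).
  elim/mpolyind: q => [|c m q _ _ IH]; first by rewrite meval0 mpolyC0 subr0.
  rewrite mevalD mpolyCD opprD addrACA; apply: (JD) => //.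
  rewrite mevalZ mpolyCM -mul_mpolyC -mulrBr; apply: (JM).
  rewrite mevalX mpolyXE_id rmorph_prod /=.
  elim/big_ind2: _ => [|b a b' a' Ja Ja'|i _]; first by rewrite subrr.
    have -> : a * a' - b * b' = a' * (a - b) + b * (a' - b') by ring.
    by apply: (JD); exact: JM.
  rewrite rmorphXn /=; elim: (m i) => [|e IHe]; first by rewrite subrr.
  have -> : Xv i ^+ e.+1 - mpolyC n (z i) ^+ e.+1 =
      Xv i ^+ e * (Xv i - mpolyC n (z i)) +
      mpolyC n (z i) * (Xv i ^+ e - mpolyC n (z i) ^+ e).
    by rewrite !exprS; ring.
  by apply: (JD); exact: JM.
have Jc a : J (mpolyC n a) -> a = 0.
  move=> Ja; apply/eqP; apply: contrapT => /negP a0; apply: (JpN 0%N).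
  by rewrite expr0 -mpolyC1 -(mulVf a0) mpolyCM; exact: JM.
apply: (JpN 1%N); rewrite expr1.
have -> : p = p - mpolyC n (meval z p); last exact: Jev.
rewrite p0 ?mpolyC0 ?subr0 // => t; apply: Jc.
have -> : mpolyC n (meval z (g t)) = g t - (g t - mpolyC n (meval z (g t))).
  by rewrite opprB addrC subrK.
apply: (JD); last exact: ideal_opp.
apply: IJ; exists (fun t' => (t' == t)%:R).
rewrite (bigD1 t) //= eqxx mul1r big1 ?addr0 // => t' /negbTE ->.
by rewrite mul0r.
Qed.

End Nullstellensatz.

(** * Regular sequences modulo a hypersurface *)

Section RegularSequence.
Variable S : comNzRingType.

(** Regularity of the images of x, y, z in S/(f), expressed in S so that it
    can be transported along automorphisms of S. *)
Definition regular_modulo (f x y z : S) : Prop :=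
  [/\ forall a h, x * a = f * h -> exists h', a = f * h',
      forall a b h, y * a = x * b + f * h -> exists b' h', a = x * b' + f * h' &
      forall a b c h, z * a = x * b + y * c + f * h ->
        exists b' c' h', a = x * b' + y * c' + f * h'].

(** Lets one choose coordinates in which regularity is easy to see. *)
Lemma regular_modulo_morph (phi psi : {rmorphism S -> S}) f x y z :
  cancel phi psi ->
  regular_modulo (phi f) (phi x) (phi y) (phi z) -> regular_modulo f x y z.
Proof.
move=> phiK [regx regy regz]; split.
- move=> a h /(congr1 phi); rewrite !rmorphM => /regx[h' /(congr1 psi)].
  by rewrite rmorphM !phiK => ->; exists (psi h').
- move=> a b h /(congr1 phi); rewrite rmorphD !rmorphM.
  move=> /regy[b' [h' /(congr1 psi)]].
  by rewrite rmorphD !rmorphM !phiK => ->; exists (psi b'), (psi h').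
move=> a b c h /(congr1 phi); rewrite !rmorphD !rmorphM.
move=> /regz[b' [c' [h' /(congr1 psi)]]].
rewrite !rmorphD !rmorphM !phiK => ->.
by exists (psi b'), (psi c'), (psi h').
Qed.
End RegularSequence.

Section MonomialIdeal.
Variables (F : fieldType) (n : nat).
Local Notation S := (mpoly n.+1 F).
Local Notation Xv i := (mpolyX F (mnm1 i) : S).
Implicit Types (A B : {set 'I_n.+1}) (e : 'I_n.+1 -> nat) (m : multinom n.+1).
Implicit Types (p q f g : S).

(** The ideal generated by the powers Xv i ^+ e i for i in A, in terms of the
    monomials of p. *)
Definition mono_ideal A e p : Prop :=
  forall m, (forall i, i \in A -> (m i < e i)%N) -> mcoeff m p = 0.

Lemma mcoeffM_eq0 p q m :
  (forall b b', m = mnm_add b b' -> mcoeff b p * mcoeff b' q = 0) ->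
  mcoeff m (p * q) = 0.
Proof. by move=> pq0; rewrite mcoeffM big1 // => -[b b'] /= /eqP/pq0. Qed.

Lemma mono_ideal0 e p : mono_ideal finset.set0 e p -> p = 0.
Proof.
by move=> p0; apply/mpolyP => m; rewrite mcoeff0 p0 // => i; rewrite inE.
Qed.

Lemma mono_ideal_zero A e : mono_ideal A e 0.
Proof. by move=> m _; rewrite mcoeff0. Qed.

Lemma mono_idealD A e p q :
  mono_ideal A e p -> mono_ideal A e q -> mono_ideal A e (p + q).
Proof. by move=> Ap Aq m mA; rewrite mcoeffD Ap // Aq // addr0. Qed.

Lemma mono_idealN A e p : mono_ideal A e p -> mono_ideal A e (- p).
Proof. by move=> Ap m mA; rewrite mcoeffN Ap // oppr0. Qed.

Lemma mono_idealM A e q p : mono_ideal A e p -> mono_ideal A e (q * p).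
Proof.
move=> Ap m mA; apply: mcoeffM_eq0 => b b' mE.
rewrite (Ap b') ?mulr0 // => i /mA; apply: leq_ltn_trans.
by rewrite mE mnmDE leq_addl.
Qed.

Lemma mono_idealS A B e p : A \subset B -> mono_ideal A e p -> mono_ideal B e p.
Proof. by move=> /fintype.subsetP AB Ap m mB; apply: Ap => i /AB/mB. Qed.

Lemma mono_idealXn A e i p : i \in A -> mono_ideal A e (Xv i ^+ e i * p).
Proof.
move=> iA; rewrite mulrC; apply: mono_idealM => m /(_ i iA) mi.
rewrite mpolyXn mcoeffX; case: eqP => // mE.
by move: mi; rewrite -mE mulmnE mnm1E eqxx mul1n ltnn.
Qed.

Lemma mono_ideal_regular_var A e i k p :
  i \notin A -> mono_ideal A e (Xv i ^+ k * p) -> mono_ideal A e p.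
Proof.
rewrite mulrC mpolyXn => iA Ap m mA.
rewrite -(mcoeffMX p (mnm_muln (mnm1 i) k)).
apply: Ap => j jA; rewrite mnmDE mulmnE mnm1E.
by case: eqP jA => [<-|_ /mA]; [rewrite (negbTE iA) | rewrite mul0n].
Qed.

Lemma divXn i k p : exists q, forall m,
  mcoeff m (p - Xv i ^+ k * q) = if (k <= m i)%N then 0 else mcoeff m p.
Proof.
elim/mpolyind: p => [|c b p _ _ [q qE]].
  by exists 0 => m; rewrite mulr0 subrr mcoeff0 if_same.
have [kb|bk] := leqP k (b i); last first.
  exists q => m; rewrite -addrA mcoeffD qE mcoeffD mcoeffZ mcoeffX.
  case: leqP => // km; case: eqP => [bm|_]; last by rewrite mulr0 addr0.
  by move: bk; rewrite bm ltnNge km.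
exists (q + c *: mpolyX F (mnm_sub b (mnm_muln (mnm1 i) k))) => m.
rewrite mulrDr -scalerAr mpolyXn -mpolyXD addmC submK; last first.
  apply/mnm_lepP => j; rewrite mulmnE mnm1E; case: eqP => [<-|_];
  by rewrite ?mul1n ?mul0n.
have -> : c *: mpolyX F b + p - (mpolyX F (mnm_muln (mnm1 i) k) * q +
    c *: mpolyX F b) = p - Xv i ^+ k * q by rewrite mpolyXn; ring.
rewrite qE mcoeffD mcoeffZ mcoeffX; case: leqP => // mk.
case: eqP => [bm|_]; last by rewrite mulr0 add0r.
by move: mk; rewrite -bm ltnNge kb.
Qed.

Lemma mono_ideal_split A e i p : mono_ideal (i |: A) e p ->
  exists q, mono_ideal A e (p - Xv i ^+ e i * q).
Proof.
move=> Ap; have [q qE] := divXn i (e i) p; exists q => m mA.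
rewrite qE; case: leqP => // mi; apply: Ap => j.
by rewrite !inE => /orP[/eqP ->|/mA].
Qed.

Definition odeg m : nat := \sum_(i < n.+1 | i != ord0) m i.

Lemma odegD m m' : odeg (mnm_add m m') = (odeg m + odeg m')%N.
Proof. by rewrite -big_split /=; apply: eq_bigr => i _; rewrite mnmDE. Qed.

Lemma odeg_eq0 m : odeg m = 0%N -> m = mnm_muln (mnm1 ord0) (m ord0).
Proof.
move=> /eqP; rewrite sum_nat_eq0 => /forallP m0; apply/mnmP => i.
rewrite mulmnE mnm1E; have := m0 i; rewrite eq_sym.
by case: eqP => [->|_ /eqP ->]; rewrite ?mul1n ?mul0n.
Qed.

(** Among the monomials of g outside the ideal take m of least degree in the
    other variables. In the product, the monomial X_0^k * m only receives the
    term c * g_m, since every monomial of f has positive degree in the other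
    variables. *)
Lemma mono_ideal_regular A e k c f g : ord0 \notin A -> c != 0 ->
  (forall m, odeg m = 0%N -> mcoeff m f = 0) ->
  mono_ideal A e ((c *: Xv ord0 ^+ k + f) * g) -> mono_ideal A e g.
Proof.
move=> A0 c0 f0 Afg m mA.
have [d] := ubnP (odeg m); elim: d m mA => // d IH m mA md.
have := Afg (mnm_add (mnm_muln (mnm1 ord0) k) m).
rewrite mulrDl mcoeffD -scalerAl mcoeffZ mpolyXn.
rewrite [mpolyX _ _ * _]mulrC mcoeffMX mcoeffM_eq0 ?addr0; last first.
  move=> b b' mE; have [/f0 ->|b_gt0] := posnP (odeg b); first by rewrite mul0r.
  rewrite (IH b') ?mulr0 // => [i iA|].
    apply: leq_ltn_trans (mA i iA); rewrite -[X in (_ <= X)%N]add0n.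
    have <- : mnm_muln (mnm1 ord0) k i = 0%N :> nat.
      by rewrite mulmnE mnm1E; case: eqP iA => // <-; rewrite (negbTE A0).
    by rewrite -mnmDE mE mnmDE leq_addl.
  apply: (@leq_trans (odeg m)); last by rewrite -ltnS.
  have : odeg (mnm_add (mnm_muln (mnm1 ord0) k) m) = odeg (mnm_add b b').
    by rewrite mE.
  rewrite !odegD (_ : odeg (mnm_muln _ _) = 0%N) ?add0n => [->|].
    by rewrite -[X in (X < _)%N]add0n ltn_add2r.
  by rewrite /odeg big1 // => i i0; rewrite mulmnE mnm1E eq_sym (negbTE i0).
move=> cg0; apply/eqP; have /eqP : c * mcoeff m g = 0.
  apply: cg0 => i iA; rewrite mnmDE mulmnE mnm1E.
  case: eqP iA => [<-|_ /mA]; first by rewrite (negbTE A0).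
  by rewrite mul0n add0n.
by rewrite mulf_eq0 (negbTE c0).
Qed.

(** Exchange of the order in a regular sequence: the polynomial monic in the
    first variable is regular modulo the powers indexed by i |: A, which makes
    Xv i regular modulo that polynomial and the powers indexed by A. *)
Lemma regular_var_mod_mono_ideal A e k c f i g h r :
  ord0 \notin i |: A -> i \notin A ->
  c != 0 -> (forall m, odeg m = 0%N -> mcoeff m f = 0) ->
  mono_ideal A e r -> Xv i ^+ e i * g = r + (c *: Xv ord0 ^+ k + f) * h ->
  exists q, mono_ideal A e (g - (c *: Xv ord0 ^+ k + f) * q).
Proof.
set f' := _ + f => A0 iA c0 f0 Ar gE.
have fh : f' * h = Xv i ^+ e i * g - r by rewrite gE addrC addKr.
have Ah : mono_ideal (i |: A) e h.
  apply: (mono_ideal_regular (k := k) A0 c0 f0); rewrite -/f' fh.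
  apply: mono_idealD; first by apply: mono_idealXn; rewrite finset.setU11.
  by apply/mono_idealN/(mono_idealS _ Ar)/finset.subsetUr.
have [q qE] := mono_ideal_split Ah; exists q.
apply: (mono_ideal_regular_var (k := e i) iA).
have -> : Xv i ^+ e i * (g - f' * q) = r + f' * (h - Xv i ^+ e i * q).
  by rewrite mulrBr gE; ring.
by apply: mono_idealD => //; exact: mono_idealM.
Qed.
End MonomialIdeal.

Section MonomialRegular.
Variables (F : fieldType) (n : nat).
Local Notation S := (mpoly n.+1 F).
Local Notation Xv i := (mpolyX F (mnm1 i) : S).

Lemma pure_powers_regular_modulo (e : 'I_n.+1 -> nat) k c (r : S) i1 i2 i3 :
  uniq [:: ord0; i1; i2; i3] -> c != 0 ->
  (forall m, odeg m = 0%N -> mcoeff m r = 0) ->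
  regular_modulo (c *: Xv ord0 ^+ k + r)
    (Xv i1 ^+ e i1) (Xv i2 ^+ e i2) (Xv i3 ^+ e i3).
Proof.
rewrite /= !inE !negb_or => /and4P[/and3P[i01 i02 i03] /andP[i12 i13] i23 _].
move=> c0 r0; split.
- move=> a h aE; have [||||q] :=
    @regular_var_mod_mono_ideal F n finset.set0 e k c r i1 a h 0 _ _ c0 r0.
  + by rewrite !inE negb_or i01.
  + by rewrite inE.
  + exact: mono_ideal_zero.
  + by rewrite add0r.
  by move=> /mono_ideal0/subr0_eq ->; exists q.
- move=> a b h aE; have [||||q] :=
    @regular_var_mod_mono_ideal F n [set i1] e k c r i2 a h
      (Xv i1 ^+ e i1 * b) _ _ c0 r0.
  + by rewrite !inE negb_or i02.
  + by rewrite inE eq_sym.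
  + by apply: mono_idealXn; rewrite inE.
  + by [].
  rewrite -[X in mono_ideal X](finset.setU0).
  move=> /mono_ideal_split[q' /mono_ideal0 /subr0_eq aq].
  by exists q', q; rewrite -aq subrK.
move=> a b b' h aE; have [||||q] :=
  @regular_var_mod_mono_ideal F n [set i2; i1] e k c r i3 a h
    (Xv i1 ^+ e i1 * b + Xv i2 ^+ e i2 * b') _ _ c0 r0.
+ by rewrite !inE !negb_or i03 i02.
+ by rewrite !inE negb_or ![i3 == _]eq_sym i13 i23.
+ by apply: mono_idealD; apply: mono_idealXn; rewrite !inE eqxx ?orbT.
+ by [].
move=> /mono_ideal_split[q']; rewrite -[X in mono_ideal X](finset.setU0).
move=> /mono_ideal_split[q'' /mono_ideal0 /subr0_eq aq].
by exists q'', q', q; rewrite -aq !subrK.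
Qed.
End MonomialRegular.

Section Shear.
Variables (F : fieldType) (n : nat) (w : mpoly.Measure.type n.+1).
Hypothesis w0 : w (mnm1 ord0) = 1%N.
Local Notation S := (mpoly n.+1 F).
Local Notation Xv i := (mpolyX F (mnm1 i) : S).

Lemma comp_mpoly_homog (lq : n.+1.-tuple S) a (f : S) :
  (forall i, tnth lq i \is ishomog1 (w (mnm1 i)) w) ->
  f \is ishomog1 a w -> comp_mpoly lq f \is ishomog1 a w.
Proof.
move=> lqw /dhomogP fa; rewrite comp_mpolyE big_seq.
apply: rpred_sum => m /fa mw; apply: rpredZ; rewrite -mw mfE.
apply: (big_ind2 (fun (d : nat) (p : S) => p \is ishomog1 d w)).
- exact: dhomog1.
- by move=> d p d' p'; exact: dhomogM.
- by move=> i _; rewrite mulnC; apply: dhomogMn.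
Qed.

(** The only power of the first variable that can occur in a homogeneous f is
    the one of the degree of f, and it does occur when f is nonzero somewhere
    on the axis. *)
Lemma pure_power_split a f : f \is ishomog1 a w ->
  (exists2 v : 'I_n.+1 -> F,
    (forall i, i != ord0 -> v i = 0) & meval v f != 0) ->
  exists c r, [/\ c != 0, forall m, odeg m = 0%N -> mcoeff m r = 0 &
    f = c *: Xv ord0 ^+ a + r].
Proof.
move=> /dhomogP fa [v v0 fv].
pose c := mcoeff (mnm_muln (mnm1 ord0) a) f.
pose r := f - c *: Xv ord0 ^+ a.
have rE m : odeg m = 0%N -> mcoeff m r = 0.
  move=> /odeg_eq0 mE; rewrite mcoeffB mcoeffZ mpolyXn mcoeffX.
  case: eqP => [<-|ma]; first by rewrite mulr1 subrr.
  rewrite mulr0 subr0; apply/eqP; rewrite mcoeff_eq0; apply/negP => /fa mwa.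
  apply: ma; rewrite [RHS]mE; congr mnm_muln; rewrite -mwa mfE (bigD1 ord0) //=.
  rewrite w0 muln1 big1 ?addn0 // => i i0.
  by rewrite mE mulmnE mnm1E eq_sym (negbTE i0) !mul0n.
exists c, r; split=> //; last by rewrite addrC subrK.
apply: contraNneq fv => c0; rewrite mevalE big_seq big1 // => m mf.
have [m0|] := posnP (odeg m).
  have := rE _ m0; rewrite /r c0 scale0r subr0 => ->; exact: mul0r.
rewrite lt0n /odeg sum_nat_eq0 => /forallPn[/= i].
rewrite negb_imply => /andP[i0 mi].
by rewrite (bigD1 i) //= v0 // expr0n (negbTE mi) mul0r mulr0.
Qed.

Lemma mpoly_rmorph_id (g : {rmorphism S -> S}) :
  (forall c p, g (c *: p) = c *: g p) -> (forall i, g (Xv i) = Xv i) ->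
  forall p, g p = p.
Proof.
move=> gZ gX; elim/mpolyind => [|c m p _ _ IH]; first exact: rmorph0.
rewrite rmorphD IH gZ mpolyXE_id rmorph_prod; congr (_ *: _ + _).
by apply: eq_bigr => i _; rewrite rmorphXn /= gX.
Qed.

(** The weighted-homogeneous substitution that maps the point (1, 0, ..., 0)
    to the point of first coordinate s and other coordinates q. *)
Definition shear (s : F) (q : 'I_n.+1 -> F) : n.+1.-tuple S :=
  [tuple if i == ord0 then s *: Xv ord0
         else Xv i + q i *: Xv ord0 ^+ w (mnm1 i) | i < n.+1].

Lemma comp_shear0 s q : comp_mpoly (shear s q) (Xv ord0) = s *: Xv ord0.
Proof. by rewrite comp_mpolyXU -tnth_nth tnth_mktuple. Qed.

Lemma comp_shear s q i : i != ord0 ->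
  comp_mpoly (shear s q) (Xv i) = Xv i + q i *: Xv ord0 ^+ w (mnm1 i).
Proof.
by move=> /negbTE i0; rewrite comp_mpolyXU -tnth_nth tnth_mktuple i0.
Qed.

Lemma shear_homog s q i : tnth (shear s q) i \is ishomog1 (w (mnm1 i)) w.
Proof.
rewrite tnth_mktuple; case: eqP => [->|_].
  by apply: rpredZ; rewrite dhomogX.
apply: rpredD; first by rewrite dhomogX.
apply: rpredZ; have : Xv ord0 \is ishomog1 1 w by rewrite dhomogX w0.
by move=> /(dhomogMn (w (mnm1 i))); rewrite mul1n.
Qed.

Lemma shearK s q p : s != 0 ->
  comp_mpoly (shear s^-1 (fun i => - q i / s ^+ w (mnm1 i)))
    (comp_mpoly (shear s q) p) = p.
Proof.
move=> s0; set q' := fun i => _.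
pose g : {rmorphism S -> S} :=
  comp_mpoly (shear s^-1 q') \o comp_mpoly (shear s q).
apply: (mpoly_rmorph_id (g := g)) => [c r|i].
  by rewrite /g /= !comp_mpolyZ.
rewrite /g /=; have [->|i0] := eqVneq i ord0.
  by rewrite comp_shear0 comp_mpolyZ comp_shear0 scalerA mulfV // scale1r.
rewrite comp_shear // rmorphD /= comp_mpolyZ rmorphXn /=.
rewrite comp_shear // comp_shear0.
rewrite exprZn scalerA -addrA -scalerDl /q' exprVn mulNr addNr.
by rewrite scale0r addr0.
Qed.

End Shear.

Section WeightedParameters.
Variables (F : fieldType) (w : mpoly.Measure.type 4).
Hypothesis w0 : w (mnm1 ord0) = 1%N.
Local Notation S := (mpoly 4 F).
Local Notation Xv i := (mpolyX F (mnm1 i) : S).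

(** Pulling back by the shear that maps (1, 0, 0, 0) to v makes f nonzero on
    the first axis, hence monic in the first variable up to a scalar; the y i
    are the coordinates that correspond to the other variables. *)
Theorem weighted_parameters a (f : S) (v : 'I_4 -> F) :
  f \is ishomog1 a w -> v ord0 != 0 -> meval v f != 0 ->
  exists c : 'I_4 -> F, forall (e : 'I_4 -> nat) i1 i2 i3,
    uniq [:: ord0; i1; i2; i3] ->
    let y i := Xv i + c i *: Xv ord0 ^+ w (mnm1 i) in
    regular_modulo f (y i1 ^+ e i1) (y i2 ^+ e i2) (y i3 ^+ e i3).
Proof.
move=> fa v0 fv; exists (fun i => - v i / v ord0 ^+ w (mnm1 i)).
move=> e i1 i2 i3 u y.
have [i10 i20 i30] : [/\ i1 != ord0, i2 != ord0 & i3 != ord0].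
  move: u; rewrite /= !inE !negb_or !(eq_sym ord0).
  by move=> /and4P[/and3P[]].
pose phi : {rmorphism S -> S} := comp_mpoly (shear w (v ord0) v).
pose psi : {rmorphism S -> S} :=
  comp_mpoly (shear w (v ord0)^-1 (fun i => - v i / v ord0 ^+ w (mnm1 i))).
have phiK : cancel phi psi by move=> p; exact: shearK.
have phiy i : i != ord0 -> phi (y i) = Xv i.
  move=> i0; rewrite rmorphD /= comp_mpolyZ rmorphXn /=.
  rewrite comp_shear // comp_shear0.
  by rewrite exprZn scalerA divfK ?expf_neq0 // scaleNr addrK.
have [|c [r [c0 r0 fE]]] :=
  pure_power_split w0 (comp_mpoly_homog (shear_homog w0 (v ord0) v) fa).
  exists (fun i => (i == ord0)%:R) => [i /negbTE -> //|].
  rewrite comp_mpoly_meval; apply: contra fv => /eqP <-; apply/eqP.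
  apply: meval_eq => i; rewrite tnth_mktuple; case: (eqVneq i ord0) => [->|i0].
    by rewrite mevalZ mevalXU eqxx mulr1.
  rewrite mevalD mevalZ rmorphXn /= !mevalXU eqxx (negbTE i0).
  by rewrite expr1n add0r mulr1.
apply: (regular_modulo_morph phiK); rewrite !rmorphXn /= !phiy // fE.
exact: pure_powers_regular_modulo.
Qed.
End WeightedParameters.

(** * The coordinate ring of the cone *)

Section PrincipalQuotient.
Variables (S : comNzRingType) (f : S).
Hypothesis f_nonunit : ~ exists g, 1 = f * g.

Definition principal : {pred S} := fun p => `[< exists q, p = f * q >].

Lemma principal_idealr_closed : idealr_closed principal.
Proof.
split; first by apply/asboolP; exists 0; rewrite mulr0.
  by apply/asboolP => -[g fg]; apply: f_nonunit; exists g.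
move=> a u v /asboolP[p ->] /asboolP[q ->]; apply/asboolP.
by exists (a * p + q); rewrite mulrDr mulrCA.
Qed.

HB.instance Definition _ := isIdealr.Build S principal principal_idealr_closed.

Lemma principal_quotient : exists (A : comNzRingType) (pi : {rmorphism S -> A}),
  (forall a, exists p, pi p = a) /\
  (forall p, pi p = 0 <-> exists q, p = f * q).
Proof.
exists {ideal_quot principal}, \pi_{ideal_quot principal}; split.
  by move=> a; exists (repr a); exact: reprK.
move=> p; split.
  move=> /eqP; rewrite -(rmorph0 (\pi_{ideal_quot principal})).
  by rewrite -Quotient.idealrBE subr0 => /asboolP.
move=> pq; apply/eqP; rewrite -(rmorph0 (\pi_{ideal_quot principal})).
by rewrite -Quotient.idealrBE subr0; apply/asboolP.
Qed.
End PrincipalQuotient.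

Lemma regular_modulo_quotient (S A : comNzRingType) (pi : {rmorphism S -> A})
    (f x y z : S) : (forall a, exists p, pi p = a) ->
  (forall p, pi p = 0 <-> exists q, p = f * q) ->
  regular_modulo f x y z -> regular_sequence (pi x) (pi y) (pi z).
Proof.
move=> pi_surj pi0 [regx regy regz].
have pif : pi f = 0 by apply/pi0; exists 1; rewrite mulr1.
have eq_mod p q : pi p = pi q -> exists h, p = q + f * h.
  move=> pq; have [h pqh] : exists h, p - q = f * h.
    by apply/pi0; rewrite rmorphB pq subrr.
  by exists h; rewrite -pqh addrC subrK.
split.
- move=> a; have [p <-] := pi_surj a; rewrite -rmorphM => /pi0[h /regx ph].
  exact/pi0.
- move=> a b; have [p <-] := pi_surj a; have [q <-] := pi_surj b.
  rewrite -!rmorphM => /eq_mod[h /regy[b' [h' ->]]].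
  by exists (pi b'); rewrite rmorphD !rmorphM pif mul0r addr0.
move=> a b c; have [p <-] := pi_surj a; have [q <-] := pi_surj b.
have [r <-] := pi_surj c; rewrite -!rmorphM -rmorphD.
move=> /eq_mod[h /regz[b' [c' [h' ->]]]].
by exists (pi b'), (pi c'); rewrite !rmorphD !rmorphM pif mul0r addr0.
Qed.

(** * Contraction with the Euler field *)

Section Contraction.
Variables (A : comNzRingType) (d : A) (e w phi : 'I_4 -> A).
Variable D : 'I_4 -> 'I_4 -> A.
Hypothesis D_skew : forall i j, D i j = - D j i.
Hypothesis D_diag : forall i, D i i = 0.
Hypothesis eD : forall j, \sum_i e i * D i j = d * w j.
Hypothesis ew : \sum_i e i * w i = 0.
Hypothesis ephi : \sum_i e i * phi i = 0.

Lemma contract_minor j : \sum_i e i * minor w phi i j = 0.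
Proof.
have -> : \sum_i e i * minor w phi i j =
    (\sum_i e i * w i) * phi j - w j * \sum_i e i * phi i.
  rewrite mulr_suml mulr_sumr -sumrB; apply: eq_bigr => i _.
  by rewrite /minor; ring.
by rewrite ew ephi mul0r mulr0 subr0.
Qed.

Lemma contract_wedge22 j k l : \sum_i e i * wedge22 D w phi i j k l = 0.
Proof.
have -> : \sum_i e i * wedge22 D w phi i j k l =
    (\sum_i e i * D i j) * minor w phi k l
    - (\sum_i e i * D i k) * minor w phi j l
    + (\sum_i e i * D i l) * minor w phi j k
    + D j k * (\sum_i e i * minor w phi i l)
    - D j l * (\sum_i e i * minor w phi i k)
    + D k l * (\sum_i e i * minor w phi i j).
  rewrite !mulr_suml !mulr_sumr -!sumrN -!big_split; apply: eq_bigr => i _ /=.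
  by rewrite /wedge22; ring.
by rewrite !contract_minor !eD /minor; ring.
Qed.

Lemma wedge22_alternating i j k l : ~~ uniq [:: i; j; k; l] ->
  wedge22 D w phi i j k l = 0.
Proof.
rewrite /= !inE andbT !negb_and !negb_or !negb_and !negbK /wedge22 /minor.
move=> /orP[/or3P[] /eqP <-|/orP[/orP[]|] /eqP <-].
- by rewrite D_diag; ring.
- by rewrite D_diag (D_skew j i); ring.
- by rewrite D_diag (D_skew j i) (D_skew k i); ring.
- by rewrite D_diag; ring.
- by rewrite D_diag (D_skew k j); ring.
- by rewrite D_diag; ring.
Qed.

(** The contraction of D /\ w /\ phi with e is zero; since this form has top
    degree, its single coefficient is then killed by every component of e. *)
Lemma contract_wedge22_eq0 m i j k l : e m * wedge22 D w phi i j k l = 0.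
Proof.
have [u|] := boolP (uniq [:: i; j; k; l]); last first.
  by move=> /wedge22_alternating ->; rewrite mulr0.
have mem x : x \in [:: i; j; k; l].
  have [||_ ->] := @uniq_min_size _ _ (enum 'I_4) u; last by rewrite mem_enum.
    by move=> y _; rewrite mem_enum.
  by rewrite size_enum_ord.
have main i' j' k' l' : (forall x, x \in [:: i'; j'; k'; l']) ->
    e i' * wedge22 D w phi i' j' k' l' = 0.
  move=> mem'; rewrite -[RHS](contract_wedge22 j' k' l') (bigD1 i') //=.
  rewrite big1 ?addr0 // => x xi; rewrite wedge22_alternating ?mulr0 //.
  by have := mem' x; rewrite !inE (negbTE xi) /= !inE => ->.
have /= := mem m; rewrite !inE => /or4P[] /eqP ->.
- exact: main.
- have := main j i k l; rewrite /wedge22 /minor (D_skew j i) => H.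
  rewrite -[RHS]oppr0 -H; first by ring.
  by move=> x; have := mem x; rewrite !inE orbCA.
- have := main k j i l.
  rewrite /wedge22 /minor (D_skew k j) (D_skew k i) (D_skew j i).
  move=> H; rewrite -[RHS]oppr0 -H; first by ring.
  by move=> x; have := mem x; rewrite !inE => /or4P[] ->; rewrite ?orbT.
have := main l j k i; rewrite /wedge22 /minor (D_skew l j) (D_skew l k).
rewrite (D_skew l i) (D_skew k i) (D_skew j i).
move=> H; rewrite -[RHS]oppr0 -H; first by ring.
by move=> x; have := mem x; rewrite !inE => /or4P[] ->; rewrite ?orbT.
Qed.

(** Contract D /\ phi = theta /\ w /\ phi with e: the left-hand side becomes d
    times w /\ phi and the right-hand side theta(e) times w /\ phi. *)
Lemma contract_division (theta : 'I_4 -> A) :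
  (forall i j l, wedge21 D phi i j l = wedge12 theta w phi i j l) ->
  forall j l, (d - \sum_i e i * theta i) * minor w phi j l = 0.
Proof.
move=> H j l.
have : \sum_i e i * wedge21 D phi i j l =
    \sum_i e i * wedge12 theta w phi i j l.
  by apply: eq_bigr => i _; rewrite H.
have -> : \sum_i e i * wedge21 D phi i j l =
   (\sum_i e i * D i j) * phi l + D j l * (\sum_i e i * phi i)
   - (\sum_i e i * D i l) * phi j.
  rewrite !mulr_suml !mulr_sumr -sumrN -!big_split; apply: eq_bigr => i _ /=.
  by rewrite /wedge21 (D_skew l i); ring.
have -> : \sum_i e i * wedge12 theta w phi i j l =
   (\sum_i e i * theta i) * minor w phi j l
   - theta j * (\sum_i e i * minor w phi i l)
   + theta l * (\sum_i e i * minor w phi i j).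
  rewrite !mulr_suml !mulr_sumr -sumrN -!big_split; apply: eq_bigr => i _ /=.
  by rewrite /wedge12 /minor; ring.
rewrite !contract_minor !eD ephi !mulr0 subr0 !addr0 mulrBl => <-.
by rewrite /minor; ring.
Qed.
End Contraction.

Section Euler.
Variables (F : numFieldType) (n : nat) (w : mpoly.Measure.type n).
Local Notation S := (mpoly n F).
Local Notation Xv i := (mpolyX F (mnm1 i) : S).

(** The components of the weighted Euler field. *)
Definition euler_coef i : S := Xv i *+ w (mnm1 i).

Lemma mulXderiv i m : Xv i * mderiv i (mpolyX F m) = mpolyX F m *+ m i.
Proof.
rewrite mderivX -scalerAr -mpolyXD.
have [->|mi] := posnP (m i); first by rewrite scale0r.
rewrite addmC submK ?scaler_nat //; apply/mnm_lepP => j.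
by rewrite mnm1E; case: eqP => // <-.
Qed.

Lemma euler_homog d (p : S) : p \is ishomog1 d w ->
  \sum_i euler_coef i * mderiv i p = p *+ d.
Proof.
move=> /dhomogP pd; rewrite {2}(mpolyE p) -sumrMnl.
under eq_bigr do rewrite {1}(mpolyE p) raddf_sum mulr_sumr.
rewrite exchange_big big_seq [RHS]big_seq; apply: eq_bigr => m /pd md /=.
under eq_bigr do rewrite mderivZ -scalerAr mulrnAl mulXderiv -mulrnA.
by rewrite -scaler_sumr -md mfE sumrMnr scalerMnr.
Qed.

Lemma mderivX1 i j : mderiv i (Xv j) = (i == j)%:R.
Proof.
rewrite mderivX mnm1E eq_sym; case: eqP => [->|_]; last by rewrite scale0r.
rewrite scale1r (_ : mnm_sub _ _ = mnm0) ?mpolyX0 //.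
by apply/mnmP => k; rewrite mnmBE subnn mnm0E.
Qed.

(** Cartan's formula: the contraction of d omega with the Euler field E is the
    Lie derivative of omega along E, as omega is killed by E; and omega is
    homogeneous of degree d, each dz_i having the weight of z_i. *)
Lemma euler_contract d (omega : 'I_n -> S) :
  (forall i, (Xv i * omega i) \is ishomog1 d w) ->
  \sum_i euler_coef i * omega i = 0 ->
  forall j, \sum_i euler_coef i * (mderiv i (omega j) - mderiv j (omega i)) =
    omega j *+ d.
Proof.
move=> omega_d omegaE j.
have Ej : \sum_i euler_coef i * mderiv i (omega j) =
    omega j *+ d - omega j *+ w (mnm1 j).
  have X0 : Xv j != 0 by rewrite -msupp_eq0 msuppX.
  apply: (mulfI X0); rewrite mulrBr !mulrnAr mulr_sumr.
  have := euler_homog (omega_d j).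
  under eq_bigr => i _.
    rewrite mderivM mderivX1 mulrDr.
    over.
  rewrite big_split /= (bigD1 j) //= eqxx mul1r big1 ?addr0; last first.
    by move=> i /negbTE ->; rewrite mul0r mulr0.
  move=> <-; rewrite {2}/euler_coef mulrnAl addrAC subrr add0r.
  by apply: eq_bigr => i _; rewrite mulrCA.
have := congr1 (mderiv j) omegaE; rewrite raddf_sum mderiv0 /=.
under eq_bigr => i _.
  rewrite mderivM /euler_coef mderivMn mderivX1.
  over.
rewrite big_split /= (bigD1 j) //= eqxx mulrnAl mul1r big1 ?addr0; last first.
  by move=> i; rewrite eq_sym => /negbTE ->; rewrite mul0rn mul0r.
move=> Ej'; under eq_bigr do rewrite mulrBr.
by rewrite sumrB Ej -addrA -opprD Ej' subr0.
Qed.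
End Euler.

(** * Regular forms on the cone *)

Section NoRegularForm.
Variables (F : numClosedFieldType) (w : mpoly.Measure.type 4).
Hypothesis F_uncountable : ~ countable (@setT F).
Hypothesis w0 : w (mnm1 ord0) = 1%N.
Hypothesis w_gt0 : forall i, (0 < w (mnm1 i))%N.
Local Notation S := (mpoly 4 F).
Local Notation Xv i := (mpolyX F (mnm1 i) : S).

Lemma homog_meval0 a (f : S) z : f \is ishomog1 a w ->
  meval z f = 0 -> meval (fun=> 0) f = 0.
Proof.
move=> /dhomogP fa fz; have [a0|a_gt0] := posnP a.
  have fC : f = mpolyC 4 (mcoeff mnm0 f).
    apply/mpolyP => m; rewrite mcoeffC.
    case: eqP => [->|m0]; first by rewrite mulr1.
    rewrite mulr0; apply/eqP; rewrite mcoeff_eq0; apply/negP => /fa wm.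
    apply: m0; apply/mnmP => i; rewrite mnm0E; apply/eqP; move/eqP: wm.
    rewrite a0 mfE sum_nat_eq0 => /forallP/(_ i).
    by rewrite muln_eq0 (gtn_eqF (w_gt0 i)) orbF.
  by move: fz; rewrite fC !mevalC.
have /(congr1 (meval (fun=> 0))) := euler_homog (introT (dhomogP _ _ _) fa).
rewrite raddf_sum big1 => [|i _] /=; last first.
  by rewrite mevalM mevalMn mevalXU mul0rn mul0r.
by move=> /esym/eqP; rewrite mevalMn mulrn_eq0 gtn_eqF //= => /eqP.
Qed.

(** A polynomial that is zero at every point is nilpotent by the
    Nullstellensatz for the empty family. *)
Lemma exists_nonzero_point (f : S) : f != 0 ->
  exists2 v : 'I_4 -> F, v ord0 != 0 & meval v f != 0.
Proof.
move=> f0; apply: contrapT => noV.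
have X0 : Xv ord0 != 0 by rewrite -msupp_eq0 msuppX.
have [z _|N [c]] :=
  @nullstellensatz F 4 F_uncountable 'I_0 (fun=> 0) (f * Xv ord0).
  apply/eqP; rewrite mevalM mevalXU mulf_eq0; apply: contrapT => /negP.
  by rewrite negb_or => /andP[fz z0]; apply: noV; exists z.
rewrite big_ord0 => /eqP.
by rewrite expf_eq0 mulf_eq0 (negbTE f0) (negbTE X0) andbF.
Qed.

(** A form with the Bott connection form theta would satisfy theta(E) = d on
    the cone, and this equality fails at the origin. *)
Theorem no_regular_form a d (f : S) (omega : 'I_4 -> S) (z : 'I_4 -> F) :
  f \is ishomog1 a w -> (0 < d)%N ->
  (forall i, (Xv i * omega i) \is ishomog1 d w) ->
  \sum_i euler_coef F w i * omega i = 0 ->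
  meval z f = 0 -> (exists i, z i != 0) ->
  ~ (forall v, meval v f = 0 -> (exists i, v i != 0) ->
     exists i j, meval v (minor omega (fun l => mderiv l f) i j) != 0).
Proof.
move=> fa d_gt0 omega_d omegaE fz z_neq0 regular.
have f_neq0 : f != 0.
  apply: contraPneq regular => f0 /(_ z fz z_neq0)[i [j]].
  by rewrite /minor f0 !mderiv0 !mulr0 subrr meval0 eqxx.
(* the cone contains the origin, so f is not a unit *)
have f00 := homog_meval0 fa fz.
have [|A [pi [pi_surj pi0]]] := @principal_quotient S f.
  move=> [g /(congr1 (meval (fun=> 0)))]; rewrite meval1 mevalM f00 mul0r.
  by move/eqP; rewrite oner_eq0.
have [v v0 fv] := exists_nonzero_point f_neq0.
have [c regc] := weighted_parameters w0 fa v0 fv.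
pose y i := Xv i + c i *: Xv ord0 ^+ w (mnm1 i).
have y0 i : meval (fun=> 0) (y i) = 0.
  by rewrite mevalD mevalZ rmorphXn /= !mevalXU expr0n gtn_eqF // mulr0 addr0.
pose phi l := mderiv l f.
(* the exponents are positive, so that the powers are multiples of the y i *)
have /choice[e eP] i : exists k,
    in_minor_ideal (pi \o omega) (pi \o phi) (pi (y i ^+ k.+1)).
  pose g (t : ('I_4 * 'I_4) + 'I_1) :=
    if t is inl p then minor omega phi p.1 p.2 else f.
  have [u gu|k [b yE]] := nullstellensatz F_uncountable (g := g) (p := y i).
    have [u0|u0] := pselect (exists i, u i != 0).
      have [i1 [i2]] := regular u (gu (inr ord0)) u0.
      by have /= := gu (inl (i1, i2)); rewrite /phi => ->; rewrite eqxx.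
    rewrite -[RHS](y0 i); apply: meval_eq => l; apply/eqP.
    by apply: contrapT => /negP ul; apply: u0; exists l.
  exists k, (fun p => pi (y i * b (inl p))).
  have pif : pi f = 0 by apply/pi0; exists 1; rewrite mulr1.
  have -> : pi (y i ^+ k.+1) =
      pi (y i) * pi (\sum_p b (inl p) * minor omega phi p.1 p.2).
    rewrite exprS yE big_sumType big_ord1 rmorphM; congr (_ * _).
    by rewrite /= rmorphD [in X in _ + X]rmorphM pif mulr0 addr0.
  rewrite rmorph_sum mulr_sumr; apply: eq_bigr => p _ /=.
  by rewrite !rmorphM mulrA /minor rmorphB !rmorphM.
pose i1 : 'I_4 := Ordinal (isT : (1 < 4)%N).
pose i2 : 'I_4 := Ordinal (isT : (2 < 4)%N).
pose i3 : 'I_4 := Ordinal (isT : (3 < 4)%N).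
have := regular_modulo_quotient pi_surj pi0
  (regc (fun i => (e i).+1) i1 i2 i3 isT).
rewrite -/(y i1) -/(y i2) -/(y i3) => regA.
have [reg1 _ _] := regA.
pose E i := pi (euler_coef F w i).
pose D i j := pi (mderiv i (omega j) - mderiv j (omega i)).
have D_skew i j : D i j = - D j i by rewrite /D -rmorphN opprB.
have D_diag i : D i i = 0 by rewrite /D subrr rmorph0.
have ED j : \sum_i E i * D i j = d%:R * (pi \o omega) j.
  under eq_bigr do rewrite /E /D -rmorphM.
  by rewrite -rmorph_sum (euler_contract omega_d omegaE) raddfMn mulr_natl.
have Eomega : \sum_i E i * (pi \o omega) i = 0.
  under eq_bigr do rewrite /E /= -rmorphM.
  by rewrite -rmorph_sum omegaE rmorph0.
have Ephi : \sum_i E i * (pi \o phi) i = 0.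
  under eq_bigr do rewrite /E /= -rmorphM.
  rewrite -rmorph_sum (euler_homog fa); apply/pi0; exists a%:R.
  by rewrite mulr_natr.
(* integrability: all coordinates kill the four-form, hence so does y i1, which
   is regular modulo f while a given coordinate may divide f *)
have D_wedge i j k l : wedge22 D (pi \o omega) (pi \o phi) i j k l = 0.
  have X0 m : pi (Xv m) * wedge22 D (pi \o omega) (pi \o phi) i j k l = 0.
    have -> : Xv m = mpolyC 4 (w (mnm1 m))%:R^-1 * euler_coef F w m.
      rewrite /euler_coef mulrnAr -mulrnAl -raddfMn /= -(mulr_natr _^-1).
      rewrite mulVf ?mul1r //.
      by rewrite pnatr_eq0 gtn_eqF.
    rewrite rmorphM -mulrA.
    by rewrite (contract_wedge22_eq0 D_skew D_diag ED Eomega Ephi) mulr0.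
  apply: reg1; rewrite exprSr rmorphM -mulrA.
  suff -> : pi (y i1) * wedge22 D (pi \o omega) (pi \o phi) i j k l = 0.
    by rewrite mulr0.
  have -> : y i1 =
      Xv i1 + mpolyC 4 (c i1) * Xv ord0 ^+ (w (mnm1 i1)).-1 * Xv ord0.
    by rewrite -mulrA -exprSr prednK // mul_mpolyC.
  by rewrite rmorphD rmorphM mulrDl -mulrA !X0 mulr0 addr0.
(* the Bott connection form *)
have [theta thetaE] := division2 (eP i1) (eP i2) (eP i3) regA D_skew D_wedge.
have dE := contract_division D_skew ED Eomega Ephi thetaE.
have /choice[t tE] i : exists p, pi p = theta i by exact: pi_surj.
(* theta(E) = d in the coordinate ring; evaluate at the origin *)
have /eqP := minor_mul_eq0 (eP i1) dE; rewrite mulrC => /eqP/reg1.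
under eq_bigr do rewrite /E -tE -rmorphM.
rewrite -rmorph_sum -(rmorph_nat pi) -rmorphB => /pi0[q].
move=> /(congr1 (meval (fun=> 0))); rewrite mevalB mevalM f00 mul0r.
rewrite rmorph_sum big1 ?subr0 => [|i _] /=; last first.
  by rewrite mevalM mevalMn mevalXU mul0rn mul0r.
by move/eqP; rewrite rmorph_nat pnatr_eq0 gtn_eqF.
Qed.

End NoRegularForm.

(** * From the distribution to forms on the cone *)

(** A countable set of reals has measure zero. *)
Lemma CC_uncountable (R : realType) : ~ countable (@setT (CC R)).
Proof.
move=> /countable_injP[g g_inj].
have cR : countable `[(0 : R), 1]%classic.
  apply/countable_injP; exists (fun x => g (real_complex R x)).
  move=> x y _ _ /(g_inj _ _ (mem_set Logic.I) (mem_set Logic.I)).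
  by move=> /(congr1 (@complex.Re R)).
have := countable_lebesgue_measure0 cR.
rewrite lebesgue_measure_itv /= lte_fin ltr01 sube0.
by move=> /eqP; rewrite eqe oner_eq0.
Qed.

Lemma wdeg_var k i : wdeg k (mnm1 i) = wt k i.
Proof.
rewrite /wdeg (bigD1 i) //= mnm1E eqxx mul1n big1 ?addn0 // => j ji.
by rewrite mnm1E eq_sym (negbTE ji).
Qed.

Lemma wt_gt0 k i : (0 < k)%N -> (0 < wt k i)%N.
Proof. by rewrite /wt; case: ifP. Qed.

(** When the minors of (omega, df) vanish, omega is proportional to df <> 0,
    so it vanishes on the kernel of df. *)
Lemma minors_neq0 (R : realType) (f : mpoly 4 (CC R))
    (omega : 'I_4 -> mpoly 4 (CC R)) (z : @punctured R) :
  (exists i, evalv (mderiv i f) z != 0) -> ~ section_vanishes_at f omega z ->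
  exists i j, evalv (minor omega (fun l => mderiv l f) i j) z != 0.
Proof.
move=> [i fi] omega_z; apply: contrapT => minors0; apply: omega_z => v fv.
apply: (mulfI fi); rewrite mulr0 mulr_sumr.
transitivity
  (evalv (omega i) z * \sum_(j < 4) evalv (mderiv j f) z * v 0 j); last first.
  by rewrite fv mulr0.
rewrite mulr_sumr; apply: eq_bigr => j _; rewrite !mulrA; congr (_ * _).
apply/esym/eqP; rewrite [X in _ == X]mulrC -subr_eq0.
apply: contrapT => /negP ij.
by apply: minors0; exists i, j; rewrite /evalv mevalB !mevalM.
Qed.

Unset Implicit Arguments.

Theorem corollary4p4 (R : realType) (k a : nat) (f : mpoly 4 (CC R)) :
  (0 < k)%N ->
  f \is ishomog1 a (wdeg k) ->
  smooth_hypersurface k f ->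
  ~ exists (d : nat) (omega : 'I_4 -> mpoly 4 (CC R)),
      codim1_distribution k f d omega /\ regular_distribution k f omega.
Proof.
move=> k_gt0 fa [smooth _] [d [omega [[d_gt0 [omega_d omegaE] [z fz _]]]]].
move=> regular.
have w0 : wdeg k (mnm1 ord0) = 1%N by rewrite wdeg_var.
have w_gt0 i : (0 < wdeg k (mnm1 i))%N by rewrite wdeg_var wt_gt0.
apply: (no_regular_form (@CC_uncountable R) w0 w_gt0 fa d_gt0 omega_d _ fz).
- rewrite -[RHS]omegaE; apply: eq_bigr => i _.
  by rewrite /euler_coef /= wdeg_var mulrnAl.
- apply: contrapT => z0; have /set_mem/eqP := valP z; apply.
  apply/rowP => i; rewrite mxE; apply/eqP; apply: contrapT => /negP zi.
  by apply: z0; exists i.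
move=> v fv [i vi].
have v_neq0 : punctured (\row_l v l : 'rV[CC R]_4).
  by apply: contraNneq vi => /rowP/(_ i); rewrite !mxE => ->.
pose p : @punctured R := SigSub (mem_set v_neq0).
have evalvE q : evalv q p = meval v q.
  by apply: meval_eq => l; rewrite /= mxE.
have fp : punctured_cone f p by rewrite /punctured_cone /= evalvE.
have [|j [l]] := minors_neq0 (omega := omega) (smooth p fp).
  move=> omega_p; have : sing f omega (wpi k p) by exists p.
  by rewrite regular.
by rewrite evalvE; exists j, l.
Qed.
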